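(* Let $m\ge 3$ be an odd integer and let $k\ge 2$ be an integer. Then $$\phi_{2m}(x)=(-1)^{\varphi(m)/2}\,\phi_m(4-x)=(-1)^{\varphi(m)/2}(\phi_m\circ\Phi_2)(x),$$ $$\phi_{2^k m}(x)=\phi_m\big((\phi_{2^k}(x))^2\big)=(\phi_m\circ\Phi_{2^k})(x).$$
   Context: $\varphi$ denotes Euler's totient function. The polynomials $\phi_n(x)$ (distinct from the totient $\varphi$) are defined by $\phi_1(x)=x$, $\phi_2(x)=x-4$, and for $n\ge 3$ by $\phi_n(x)=(-1)^{\varphi(n)/2}\psi_n(2-x)$, where $\psi_n(x)=\prod_{\gcd(j,n)=1,\ 0<j<n/2}\left(x-2\cos\frac{2\pi j}{n}\right)$ is the minimal polynomial over $\mathbb{Q}$ of $2\cos\left(\frac{2\pi}{n}\right)$. Equivalently, for $n\ge 3$, $\phi_n(x)=\prod_{\gcd(j,n)=1,\ 0<j<n/2}\left(x-4\sin^2\left(\frac{j\pi}{n}\right)\right)$, which is the minimal polynomial of $4\sin^2\left(\frac{\pi}{n}\right)$. The polynomials $\Phi_n(x)$ are defined by $\Phi_1(x)=x$, $\Phi_2(x)=4-x$, and $\Phi_n(x)=(\phi_n(x))^2$ for $n\ge 3$. *)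

(* Defs.v *)
From mathcomp Require Import all_boot all_order all_algebra.
From mathcomp Require Import reals trigo.

Set Implicit Arguments.
Unset Strict Implicit.
Unset Printing Implicit Defensive.

Import GRing.Theory Num.Theory.

Local Open Scope ring_scope.

Definition psi (R : realType) (n : nat) : {poly R} :=
  \prod_(1 <= j < n | coprime j n && (2 * j < n)%N)
    ('X - (2 * cos (2 * pi * j%:R / n%:R))%:P).

(* The index n = 0 is not used; the last branch gives 1 there. For n >= 3,
   totient n is even, so the division by 2 in the exponent is exact. *)
Definition phi (R : realType) (n : nat) : {poly R} :=
  match n with
  | 1 => 'X
  | 2 => 'X - 4%:P
  | _ => (-1) ^+ (totient n %/ 2) * (psi R n \Po (2%:P - 'X))
  end.

Definition Phi (R : realType) (n : nat) : {poly R} :=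
  match n with
  | 1 => 'X
  | 2 => 4%:P - 'X
  | _ => phi R n ^+ 2
  end.

(* Main.v *)
Require Import Defs.
From mathcomp Require Import all_boot all_order all_algebra.
From mathcomp Require Import reals trigo.
From mathcomp Require Import ring zify.

(** For n >= 3, substituting x = 2 - y turns [phi R n] into [psi R n] up to the
    sign (-1) ^ (totient n / 2), so both identities are statements about the
    monic polynomials psi_n, whose roots are the numbers 2 cos (2 pi j / n) with
    j coprime to n. Such identities are proved by comparing roots: [eq_psi] says
    that a monic polynomial of degree totient n / 2 which vanishes at all these
    numbers is psi_n, and [root_psi] provides the vanishing.

    For odd m, adding pi to the angle 2 pi j / (2 m) with j odd gives
    2 pi i / m with i = (j + m) / 2; since cos (t + pi) = - cos t, this yields
    psi_(2m) (y) = (-1) ^ (totient m / 2) psi_m (- y), and the first identity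
    follows because 2 - (4 - x) = - (2 - x).

    For powers of two, let D_k ([dbl k]) be the monic polynomial that sends
    2 cos t to 2 cos (2 ^ k t), so D_0 = y and D_(k+1) = D_k ^ 2 - 2. For even n,
    multiplying n by 2 ^ k multiplies the totient by 2 ^ k and coprimality to
    2 ^ k n is coprimality to n, hence psi_(2^k n) = psi_n o D_k
    ([psi_mul_pow2]). The case n = 4 gives psi_(2^(k+2)) = D_k, and the case
    n = 2 m gives psi_(2^(k+2) m) = psi_(2m) o D_(k+1), that is, up to sign,
    psi_m o (- D_(k+1)) = psi_m o (2 - D_k ^ 2). This is the second identity in
    the variable y; its signs disappear because totient (2 ^ k m) / 2 is even
    and because phi_(2^k) is squared. *)

Set Implicit Arguments.
Unset Strict Implicit.
Unset Printing Implicit Defensive.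

Import GRing.Theory Num.Theory.

Local Open Scope ring_scope.

(** * The totient and its halves *)

Lemma coprime_subl (j n : nat) : (j <= n)%N -> coprime (n - j) n = coprime j n.
Proof.
by move=> jn; rewrite /coprime -[X in gcdn (n - j) X](subnK jn)
  -[X in gcdn j X](subnK jn) gcdnDl gcdnDr gcdnC.
Qed.

(** The reflection j |-> n - j preserves coprimality to n and exchanges the
    two halves of the range; no j coprime to n >= 3 is its own mirror image. *)
Lemma totient_double_count (n : nat) : (3 <= n)%N ->
  totient n
  = (2 * count (fun j => coprime j n && (2 * j < n)%N) (index_iota 1 n))%N.
Proof.
move=> n3; set P := (fun j => _); set c := count _ _; rewrite mul2n -addnn.
have cE : c = (\sum_(1 <= j < n) P j)%N by rewrite /c -sum1_count big_mkcond /=;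
  apply: eq_bigr => j _; case: (P j).
rewrite {2}cE big_nat_rev cE totient_count_coprime big_ltn /=; last by lia.
have -> : coprime n 0 = false by rewrite /coprime gcdn0; lia.
rewrite add0n -big_split; apply: eq_big_nat => j /andP[j1 jn] /=.
rewrite add1n subSS /P coprime_subl; last exact: ltnW.
rewrite coprime_sym.
case: (boolP (coprime j n)) => //= cjn.
have : n != (2 * j)%N.
  by apply/eqP => nE; move: cjn; rewrite nE /coprime gcdnMl; lia.
by lia.
Qed.

Lemma totientE_half (n : nat) : (3 <= n)%N ->
  totient n = (2 * (totient n %/ 2))%N.
Proof. by move=> /totient_double_count->; rewrite mulKn. Qed.

Lemma totient_mul_pow2 (k n : nat) : (0 < n)%N -> ~~ odd n ->
  totient (2 ^ k * n) = (2 ^ k * totient n)%N.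
Proof.
move=> n0 en; have [o co ->] := pfactor_coprime (isT : prime 2) n0.
have : (0 < logn 2 n)%N by rewrite logn_gt0 mem_primes n0 dvdn2 en.
case: (logn 2 n) => // a _; rewrite mulnCA -expnD addnS.
rewrite !totient_coprime ?coprimeXr 1?coprime_sym ?co //.
by rewrite !totient_pfactor //= !mul1n expnD mulnCA.
Qed.

(** * The roots of psi *)

Section RealType.
Variable R : realType.
Implicit Types (p : {poly R}) (n m i j k : nat) (x : R).

Lemma monic_psi n : psi R n \is monic.
Proof. exact: monic_prod_XsubC. Qed.

Lemma size_psi n : (3 <= n)%N -> size (psi R n) = (totient n %/ 2).+1.
Proof.
by move=> n3; rewrite /psi -big_filter size_prod_XsubC size_filter
  totient_double_count // mulKn.
Qed.

(** Cosine is injective on [0, pi], where the angles with 2 j < n lie; hence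
    the roots listed in [psi] are distinct, [psi] divides p, and equal degrees
    and leading coefficients force equality. *)
Lemma eq_psi n p : (3 <= n)%N -> p \is monic ->
    size p = (totient n %/ 2).+1 ->
    (forall j, coprime j n -> root p (2 * cos (2 * pi * j%:R / n%:R))) ->
  p = psi R n.
Proof.
move=> n3 pm sp rp; apply/eqP; rewrite eq_sym -eqp_monic ?monic_psi //.
rewrite -dvdp_size_eqp ?size_psi ?sp //.
rewrite /psi -big_filter; set s := filter _ _.
rewrite -(big_map (fun j : nat => 2 * cos (2 * pi * j%:R / n%:R)) predT
  (fun z => 'X - z%:P)).
apply: uniq_roots_dvdp.
  apply/allP => _ /mapP[j + ->]; rewrite mem_filter => /andP[/andP[cj _] _].
  exact: rp.
rewrite uniq_rootsE map_inj_in_uniq ?filter_uniq ?iota_uniq //.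
have n0 : 0 < n%:R :> R by rewrite ltr0n; lia.
have angle j : j \in s -> 2 * pi * j%:R / n%:R \in `[0, pi : R].
  rewrite mem_filter => /andP[/andP[_ jn] _].
  rewrite in_itv /= divr_ge0 ?mulr_ge0 ?pi_ge0 ?ler0n //=.
  rewrite ler_pdivrMr // mulrAC mulrC ler_wpM2l ?pi_ge0 //.
  by rewrite -natrM ler_nat ltnW.
have two0 : 2 != 0 :> R by rewrite pnatr_eq0.
have tp0 : 2 * pi != 0 :> R by rewrite mulf_neq0 // lt0r_neq0 ?pi_gt0.
have nV0 : n%:R^-1 != 0 :> R by rewrite invr_eq0 lt0r_neq0.
move=> i j si sj /(mulfI two0) /(cos_inj (angle i si) (angle j sj)).
by move=> /(mulIf nV0) /(mulfI tp0) /eqP; rewrite eqr_nat => /eqP.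
Qed.

(** Periodicity reduces j modulo n, and evenness of the cosine then allows
    replacing j by n - j, so that j falls in the range of [psi]. *)
Lemma root_psi n j : (3 <= n)%N -> coprime j n ->
  root (psi R n) (2 * cos (2 * pi * j%:R / n%:R)).
Proof.
move=> n3; have n0 : n%:R != 0 :> R by rewrite pnatr_eq0; lia.
have small i : coprime i n -> (2 * i < n)%N ->
    root (psi R n) (2 * cos (2 * pi * i%:R / n%:R)).
  move=> ci lti; have i1 : (0 < i)%N.
    by rewrite lt0n; apply/eqP => i0; move: ci; rewrite i0 /coprime gcd0n; lia.
  rewrite /psi -big_filter.
  rewrite -(big_map (fun j : nat => 2 * cos (2 * pi * j%:R / n%:R)) predT
    (fun z => 'X - z%:P)) root_prod_XsubC.
  by apply: map_f; rewrite mem_filter ci lti mem_index_iota; lia.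
rewrite -coprime_modl => cj.
have -> : 2 * pi * j%:R / n%:R
    = 2 * pi * (j %% n)%:R / n%:R + pi *+ 2 *+ (j %/ n) :> R.
  rewrite {1}(divn_eq j n) natrD natrM.
  rewrite -[pi *+ 2]mulr_natl -[_ *+ (j %/ n)]mulr_natl.
  by field.
rewrite (periodicn (@cosD2pi R)); set i := (j %% n)%N in cj *.
have ltin : (i < n)%N by rewrite ltn_mod; lia.
case: (ltnP (2 * i) n) => [|le_n]; first exact: small.
have -> : 2 * pi * i%:R / n%:R
    = - (2 * pi * (n - i)%:R / n%:R) + pi *+ 2 :> R.
  by rewrite (natrB _ (ltnW ltin)) -mulr_natl; field.
rewrite cosD2pi cosN; apply: small; first by rewrite (coprime_subl (ltnW ltin)).
have : n != (2 * i)%N.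
  by apply/eqP => nE; move: cj; rewrite nE /coprime gcdnMl; lia.
by lia.
Qed.

(** * Doubling an odd index *)

Lemma totient_double m : odd m -> totient (2 * m) = totient m.
Proof. by move=> om; rewrite totient_coprime ?coprime2n //; exact: mul1n. Qed.

(** A root 2 cos (2 pi j / (2 m)) of the left side is minus the root of
    [psi R m] of index (j + m) / 2, an integer because j is odd. The sign makes
    the right side monic. *)
Lemma psi_double m : (3 <= m)%N -> odd m ->
  psi R (2 * m) = (-1) ^+ (totient m %/ 2) * (psi R m \Po (- 'X)).
Proof.
move=> m3 om; have m0 : m%:R != 0 :> R by rewrite pnatr_eq0; lia.
have sN : size (- 'X : {poly R}) = 2 by rewrite size_polyN size_polyX.
rewrite -[-1]polyCN -polyC_exp mul_polyC.
apply/esym/eq_psi; first by lia.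
- rewrite monicE lead_coefZ lead_coef_comp ?sN // (monicP (monic_psi m)).
  rewrite lead_coefN lead_coefX size_psi // mul1r -exprMn mulrNN mulr1.
  by rewrite expr1n.
- rewrite size_scale ?signr_eq0 // size_comp_poly2 // size_psi //.
  by rewrite totient_double.
move=> j; rewrite coprimeMr coprimen2 => /andP[oj cjm].
rewrite rootZ ?signr_eq0 // /root horner_comp hornerN hornerX.
have dE : (j + m = 2 * (j + m)./2)%N by rewrite mul2n halfK oddD oj om subn0.
suff -> : - (2 * cos (2 * pi * j%:R / (2 * m)%:R))
    = 2 * cos (2 * pi * (j + m)./2%:R / m%:R) :> R.
  apply: (root_psi m3).
  have : coprime (2 * (j + m)./2) m.
    by rewrite -dE /coprime -gcdn_modl modnDr gcdn_modl.
  by rewrite coprimeMl => /andP[].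
rewrite -mulrN -cosDpi; congr (_ * cos _).
have -> : (j%:R : R) = 2 * (j + m)./2%:R - m%:R.
  by rewrite -natrM -dE natrD addrK.
by rewrite natrM; field.
Qed.

(** * Multiplying an even index by a power of two *)

(** The Chebyshev-like polynomials of degree 2 ^ k obtained by iterating the
    duplication formula 2 cos (2 t) = (2 cos t) ^ 2 - 2. *)
Fixpoint dbl k : {poly R} := if k is k'.+1 then dbl k' ^+ 2 - 2%:P else 'X.

Lemma dbl_cos k x : (dbl k).[2 * cos x] = 2 * cos (2 ^+ k * x).
Proof.
elim: k => [|k IHk] /=; first by rewrite hornerX expr0 mul1r.
have -> : 2 ^+ k.+1 * x = (2 ^+ k * x) *+ 2 by rewrite exprS; ring.
by rewrite !hornerE IHk cos_mulr2n; ring.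
Qed.

Lemma size_monic_dbl k : size (dbl k) = (2 ^ k).+1 /\ dbl k \is monic.
Proof.
elim: k => [|k [IHs IHm]] /=; first by rewrite size_polyX monicX.
have m2 : dbl k ^+ 2 \is monic by rewrite monic_exp.
have s2 : size (dbl k ^+ 2) = (2 ^ k.+1).+1.
  have := size_exp (dbl k) 2; rewrite IHs /= -expnSr => <-.
  by rewrite prednK // size_poly_gt0 monic_neq0.
have lt2 : (size (- 2%:P : {poly R}) < size (dbl k ^+ 2))%N.
  by rewrite s2 size_polyN size_polyC pnatr_eq0 ltnS expn_gt0.
by rewrite size_polyDl // s2 monicE lead_coefDl // (monicP m2).
Qed.

(** The polynomial [dbl k] maps the candidate root of index j for 2 ^ k * n to
    the one for n with the same j, and coprimality to 2 ^ k * n implies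
    coprimality to n. Evenness of n makes the degrees agree. *)
Lemma psi_mul_pow2 n k : (3 <= n)%N -> ~~ odd n ->
  psi R (2 ^ k * n) = psi R n \Po dbl k.
Proof.
move=> n3 en; have [sd md] := size_monic_dbl k.
have k0 : (0 < 2 ^ k)%N by rewrite expn_gt0.
have sd1 : (1 < size (dbl k))%N by rewrite sd ltnS.
have mc : psi R n \Po dbl k \is monic.
  rewrite monicE lead_coef_comp // (monicP md) (monicP (monic_psi n)).
  by rewrite expr1n mulr1.
apply/esym/eq_psi => //; first by rewrite (leq_trans n3) // leq_pmull.
  rewrite -[LHS]prednK ?size_poly_gt0 ?monic_neq0 // size_comp_poly.
  rewrite size_psi // sd /= totient_mul_pow2 //; last by lia.
  by rewrite {2}(totientE_half n3) mulnCA mulKn // mulnC.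
move=> j; rewrite coprimeMr => /andP[_ cj].
rewrite /root horner_comp dbl_cos.
suff -> : 2 ^+ k * (2 * pi * j%:R / (2 ^ k * n)%:R) = 2 * pi * j%:R / n%:R :> R.
  exact: root_psi.
rewrite natrM natrX; field.
by rewrite expf_neq0 ?pnatr_eq0 //; lia.
Qed.

Lemma psi4 : psi R 4 = 'X.
Proof.
apply/esym/eq_psi => //; first exact: monicX.
  by rewrite size_polyX (@totient_pfactor 2 2).
move=> j; rewrite -[4%N]/(2 ^ 2)%N coprime_pexpr // coprimen2 => oj.
rewrite /root hornerX.
have -> : 2 * pi * j%:R / 4 = pi / 2 + pi *+ j./2 :> R.
  rewrite -{1}(odd_double_half j) oj natrD -mul2n natrM -[pi *+ _]mulr_natl.
  by rewrite /=; field.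
by rewrite (alternatingn (@cosDpi R)) cos_pihalf !mulr0.
Qed.

Lemma psi_pow2 k : psi R (2 ^ k.+2) = dbl k.
Proof. by rewrite -(addn2 k) expnD psi_mul_pow2 // psi4 comp_polyX. Qed.

(** * From psi to phi *)

Lemma phiE n : (3 <= n)%N ->
  phi R n = (-1) ^+ (totient n %/ 2) * (psi R n \Po (2%:P - 'X)).
Proof. by case: n => [|[|[]]]. Qed.

Lemma phi_comp n p : (3 <= n)%N ->
  phi R n \Po p = (-1) ^+ (totient n %/ 2) * (psi R n \Po (2%:P - p)).
Proof.
move=> n3; rewrite phiE // comp_polyM -comp_polyA.
rewrite comp_polyB comp_polyC comp_polyX.
by rewrite -[-1]polyCN -polyC_exp comp_polyC.
Qed.
End RealType.

Theorem theorem6p1 (R : realType) (m k : nat)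
    (hm3 : (3 <= m)%N) (hmodd : odd m) (hk : (2 <= k)%N) :
  [/\ phi R (2 * m) = (-1) ^+ (totient m %/ 2) * (phi R m \Po (4%:P - 'X)),
      (-1) ^+ (totient m %/ 2) * (phi R m \Po (4%:P - 'X)) =
        (-1) ^+ (totient m %/ 2) * (phi R m \Po Phi R 2),
      phi R (2 ^ k * m) = phi R m \Po (phi R (2 ^ k) ^+ 2)
    & phi R m \Po (phi R (2 ^ k) ^+ 2) = phi R m \Po Phi R (2 ^ k)].
Proof.
have m2 : (3 <= 2 * m)%N by lia.
have e2 : ~~ odd (2 * m) by rewrite oddM.
have k3 : (3 <= 2 ^ k)%N.
  by apply: (@leq_trans (2 ^ 2)) => //; rewrite leq_exp2l.
split=> //.
- rewrite phiE // psi_double // totient_double // phi_comp //.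
  rewrite comp_polyM -comp_polyA -[-1]polyCN -polyC_exp comp_polyC.
  congr (_ * (_ * (_ \Po _))).
  (* Both inner polynomials are 'X - 2. *)
  by rewrite linearN /= comp_polyX (natrD R 2 2) polyCD; ring.
- (* 2 ^ k = 2 ^ l * 4 serves phi_(2^k), and 2 ^ k * m = 2 ^ l.+1 * (2 * m)
     serves phi_(2^k m). *)
  have [l kE] : exists l, k = l.+2 by exists k.-2; lia.
  have pE : (2 ^ k * m = 2 ^ l.+1 * (2 * m))%N by rewrite kE !expnS; ring.
  have even_exp : odd (totient (2 ^ k * m) %/ 2) = false.
    rewrite pE totient_mul_pow2 //; last by lia.
    by rewrite totient_double // (totientE_half hm3) mulnCA mulKn // oddM oddX.
  have sqrE : phi R (2 ^ k) ^+ 2 = dbl R l ^+ 2 \Po (2%:P - 'X).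
    by rewrite phiE // exprMn sqrr_sign mul1r kE psi_pow2 !expr2 comp_polyM.
  rewrite phi_comp // phiE; last first.
    by rewrite (leq_trans m2) // pE leq_pmull ?expn_gt0.
  rewrite -signr_odd even_exp mul1r pE psi_mul_pow2 // psi_double // sqrE.
  rewrite !comp_polyM -[-1]polyCN -polyC_exp !comp_polyC -!comp_polyA.
  (* Both inner polynomials are 2 - D_l (2 - 'X) ^ 2. *)
  congr (_ * (_ \Po _)) => /=.
  by rewrite linearN /= comp_polyX comp_polyB comp_polyC expr2 comp_polyM opprB.
- by case: (2 ^ k)%N k3 => [|[|[]]].
Qed.
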